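(* Let $\mathbf H_1,\dots,\mathbf H_p$ be Hermitian $d\times d$ matrices with $\mathbf H_l^2=\mathbf I$ (two-level Hamiltonians), $\mathbf M$ Hermitian, and $\mathcal S$ any dataset, and suppose the instance is non-degenerate, i.e. $L(\cdot;\mathcal S)$ has finitely many critical points within one period. Then within one period $[0,\pi)^p$, $L(\boldsymbol\theta;\mathcal S)$ has at most $(4p)^p$ local minima.
   Context: A $p$-parameter QNN is given by Hermitian $\mathbf H_1,\dots,\mathbf H_p$ and Hermitian observable $\mathbf M$; $\mathbf U(\boldsymbol\theta)=e^{-i\theta_p\mathbf H_p}\cdots e^{-i\theta_1\mathbf H_1}$. A dataset is a finite set $\mathcal S=\{(\boldsymbol\rho_i,y_i)\}_{i=1}^m$ of density matrices (PSD, trace 1) and real labels, with loss $L(\boldsymbol\theta;\mathcal S)=\frac1m\sum_i\big(\operatorname{tr}(\mathbf U(\boldsymbol\theta)\boldsymbol\rho_i\mathbf U(\boldsymbol\theta)^\dagger\mathbf M)-y_i\big)^2$, which is $\pi$-periodic in each coordinate when $\mathbf H_l^2=\mathbf I$. *)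

(* Defs.v *)
From HB Require Import structures.
From mathcomp Require Import all_boot all_order all_algebra.
From mathcomp Require Import all_classical all_reals all_analysis.
From mathcomp Require Import complex.
Set Implicit Arguments. Unset Strict Implicit. Unset Printing Implicit Defensive.
Import Order.TTheory GRing.Theory Num.Theory.
Import numFieldNormedType.Exports.
Local Open Scope ring_scope.
Local Open Scope complex_scope.
Local Open Scope classical_set_scope.

Definition dagger (R : rcfType) (m n : nat) (A : 'M[R[i]]_(m, n)) : 'M[R[i]]_(n, m) :=
  (map_mx conjc A)^T.

Definition is_hermitian (R : rcfType) (d : nat) (A : 'M[R[i]]_d) : Prop :=
  dagger A = A.

Definition density_matrix (R : rcfType) (d : nat) (rho : 'M[R[i]]_d) : Prop :=
  [/\ is_hermitian rho,
      (forall v : 'rV[R[i]]_d, 0 <= (v *m rho *m dagger v) 0 0)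
    & \tr rho = 1].

(* R[i] viewed as a numClosedFieldType, to get its canonical (modulus) topology *)
Definition Cx (R : realType) : numClosedFieldType := R[i].

Definition expmx_partial (R : realType) (d : nat) (A : 'M[R[i]]_d) (n : nat)
  : 'M[R[i]]_d :=
  \sum_(k < n) ((k`!%:R)^-1 *: (A ^+ k)).

Definition expmx (R : realType) (d : nat) (A : 'M[R[i]]_d) : 'M[R[i]]_d :=
  \matrix_(i, j)
    (limn ((fun n => expmx_partial A n i j) : nat -> Cx R) : R[i]).

(* U(theta) = e^{-i theta_p H_p} ... e^{-i theta_1 H_1};
   here parameters/Hamiltonians are indexed by 'I_p (0-based). *)
Definition qnn_unitary (R : realType) (d p : nat) (H : 'I_p -> 'M[R[i]]_d)
  (theta : 'rV[R]_p) : 'M[R[i]]_d :=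
  \prod_(l < p)
     expmx ((- ('i * (theta 0 (rev_ord l))%:C)) *: H (rev_ord l)).

Definition qnn_loss (R : realType) (d p : nat) (H : 'I_p -> 'M[R[i]]_d)
  (M : 'M[R[i]]_d) (S : seq ('M[R[i]]_d * R)) (theta : 'rV[R]_p) : R :=
  let U := qnn_unitary H theta in
  (size S)%:R^-1 *
  \sum_(s <- S) (complex.Re (\tr (U *m s.1 *m dagger U *m M)) - s.2) ^+ 2.

Definition in_period (R : realType) (p : nat) (theta : 'rV[R]_p) : Prop :=
  forall l : 'I_p, 0 <= theta 0 l < pi.

Definition critical_point (R : realType) (p : nat) (f : 'rV[R]_p -> R)
  (theta : 'rV[R]_p) : Prop :=
  forall l : 'I_p, is_derive theta (delta_mx 0 l) f 0.

Definition local_min (R : realType) (p : nat) (f : 'rV[R]_p -> R)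
  (theta : 'rV[R]_p) : Prop :=
  \forall x \near theta, f theta <= f x.

(* Main.v *)
(* Conjugating by e^{-i t H} with H^2 = 1 makes every model output an affine
   function of (cos 2t, sin 2t) in each coordinate, so each partial derivative F_l
   of the loss is, coordinatewise, a trigonometric polynomial of degree 2 in
   2 theta_l. Suppose there are N > D = (4p)^p local minima a_j, and let u be a wave
   of degree 1 that separates them. The (D+1)(K+1)^p functions
   u^k prod_l F_l^{b_l} (k <= D, b_l <= K) all have degree <= 2pK + D, hence are
   determined by their values on a grid of (4pK + 2D + 1)^p points; for large K they
   are linearly dependent. On the other hand each a_j is a strict minimum, so
   minimising loss - <y, theta> near a_j gives, for all small y, a point x_j near
   a_j with F (x_j) = y. Substituted in the relation, the x_j give N > D distinct
   roots u (x_j) of a polynomial of degree <= D, whose coefficients, polynomials in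
   y, therefore vanish for all small y: the relation is trivial. *)
Require Import Defs.
From HB Require Import structures.
From mathcomp Require Import all_boot all_order all_algebra.
From mathcomp Require Import all_classical all_reals all_analysis.
From mathcomp Require Import complex.
From mathcomp Require Import ring lra zify.
Import Order.TTheory GRing.Theory Num.Theory.
Import numFieldNormedType.Exports.
Local Open Scope ring_scope.
Local Open Scope classical_set_scope.

Set Implicit Arguments.
Unset Strict Implicit.
Unset Printing Implicit Defensive.

(** * Trigonometric polynomials in one variable *)

Definition circ {R : realType} (t : R) : R[i] := (cos (2 * t) +i* sin (2 * t))%C.

Lemma circD (R : realType) (a b : R) : circ (a + b) = circ a * circ b.
Proof.
rewrite /circ mulrDr cosD sinD; apply/eqP; rewrite eq_complex /=.
by rewrite eqxx /= addrC [X in _ + X]mulrC [X in X + _]mulrC mulrC; apply/eqP; ring.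
Qed.

Lemma circ_neq0 (R : realType) (a : R) : circ a != 0.
Proof.
have : circ a * circ (- a) = 1.
  by rewrite -circD subrr /circ mulr0 cos0 sin0.
by apply: contra_eq_neq => ->; rewrite mul0r eq_sym oner_neq0.
Qed.

(* [g] is a Laurent polynomial of degree at most [n] in [circ t = e^{2it}]. *)
Definition trig_deg {R : realType} (n : nat) (g : R -> R) : Prop :=
  exists2 q : {poly R[i]}, (size q <= n.*2.+1)%N
    & forall t, (g t)%:C%C * circ t ^+ n = q.[circ t].

Lemma trig_deg_cst (R : realType) (c : R) : trig_deg 0 (fun=> c).
Proof.
exists (c%:C%C)%:P => [|t]; first by rewrite size_polyC; case: eqP.
by rewrite hornerC mulr1.
Qed.

Lemma trig_degM (R : realType) (m n : nat) (f g : R -> R) :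
  trig_deg m f -> trig_deg n g -> trig_deg (m + n) (fun t => f t * g t).
Proof.
move=> [q sq qE] [r sr rE]; exists (q * r) => [|t].
  apply: leq_trans (size_polyMleq _ _) _.
  by lia.
by rewrite hornerM -qE -rE exprD rmorphM /=; ring.
Qed.

Lemma trig_degD (R : realType) (n : nat) (f g : R -> R) :
  trig_deg n f -> trig_deg n g -> trig_deg n (fun t => f t + g t).
Proof.
move=> [q sq qE] [r sr rE]; exists (q + r) => [|t].
  by apply: leq_trans (size_polyD _ _) _; rewrite geq_max sq.
by rewrite hornerD -qE -rE rmorphD mulrDl.
Qed.

Lemma trig_deg_le (R : realType) (m n : nat) (f : R -> R) :
  (m <= n)%N -> trig_deg m f -> trig_deg n f.
Proof.
move=> /subnKC <- [q sq qE]; exists (q * 'X^(n - m)) => [|t].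
  apply: leq_trans (size_polyMleq _ _) _.
  by rewrite size_polyXn; lia.
by rewrite hornerM -qE hornerXn exprD mulrA.
Qed.

Lemma trig_deg_wave (R : realType) (a b c : R) :
  trig_deg 1 (fun t => a + b * cos (2 * t) + c * sin (2 * t)).
Proof.
(* Euler's formulas: [p0] and [p2] are the coefficients of e^{-2it} and e^{2it}; multiplication by
   [circ t] shifts the exponents to 0, 1, 2. *)
pose p0 := (b / 2 +i* (c / 2))%C : R[i].
pose p2 := (b / 2 -i* (c / 2))%C : R[i].
exists (Poly [:: p0; a%:C%C; p2]) => [|t]; first exact: size_Poly.
rewrite horner_Poly /= /circ /p0 /p2.
have cs := cos2Dsin2 (2 * t).
set C := cos _ in cs *; set S := sin _ in cs *.
have h : S ^+ 2 = 1 - C ^+ 2 by rewrite -cs; ring.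
by apply/eqP; rewrite eq_complex /=; apply/andP; split; apply/eqP; field: h.
Qed.

(** The numerator [q] has degree at most 2n and 2n + 1 distinct roots [circ (tau i)], so it is zero;
    since [circ] never vanishes, so is [g]. *)
Lemma trig_deg_eq0 (R : realType) (n : nat) (g : R -> R) (tau : 'I_(n.*2.+1) -> R) :
  trig_deg n g -> injective (circ \o tau) -> (forall i, g (tau i) = 0) ->
  forall t, g t = 0.
Proof.
move=> [q sq qE] tau_inj g0 t.
have q0 : q = 0.
  apply: contraTeq sq => q0; rewrite -ltnNge.
  have := @max_poly_roots _ q [seq circ (tau i) | i : 'I_(n.*2.+1)] q0.
  rewrite size_map size_enum_ord; apply.
    by apply/allP => _ /mapP[i _ ->]; rewrite rootE -qE g0 mul0r.
  by rewrite map_inj_uniq ?enum_uniq.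
have /eqP := qE t; rewrite q0 horner0 mulf_eq0 expf_eq0 (negPf (circ_neq0 _)).
by rewrite andbF orbF => /eqP[].
Qed.

(** * Trigonometric polynomials in several variables: interpolation on a grid and linear
    dependence *)

(** The degree is bounded on every line parallel to an axis, one coordinate at a time; no joint
    Laurent expansion has to be exhibited. *)
Definition mtrig {R : realType} {p : nat} (n : nat) (G : 'rV[R]_p -> R) : Prop :=
  forall theta l, trig_deg n (fun t => G (theta + t *: delta_mx 0 l)).

Lemma mtrig_cst (R : realType) (p : nat) (c : R) : @mtrig R p 0 (fun=> c).
Proof. by move=> theta l; exact: trig_deg_cst. Qed.

Lemma mtrigM (R : realType) (p m n : nat) (F G : 'rV[R]_p -> R) :
  mtrig m F -> mtrig n G -> mtrig (m + n) (fun theta => F theta * G theta).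
Proof. by move=> hF hG theta l; exact: trig_degM. Qed.

Lemma mtrigD (R : realType) (p n : nat) (F G : 'rV[R]_p -> R) :
  mtrig n F -> mtrig n G -> mtrig n (fun theta => F theta + G theta).
Proof. by move=> hF hG theta l; exact: trig_degD. Qed.

Lemma mtrig_le (R : realType) (p m n : nat) (F : 'rV[R]_p -> R) :
  (m <= n)%N -> mtrig m F -> mtrig n F.
Proof. by move=> le_mn hF theta l; exact: trig_deg_le (hF theta l). Qed.

Lemma mtrigZ (R : realType) (p n : nat) (c : R) (F : 'rV[R]_p -> R) :
  mtrig n F -> mtrig n (fun theta => c * F theta).
Proof. by move=> /(mtrigM (mtrig_cst c)). Qed.

Lemma mtrig_sum (R : realType) (p n : nat) (I : Type) (s : seq I)
    (F : I -> 'rV[R]_p -> R) :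
  (forall i, mtrig n (F i)) -> mtrig n (fun theta => \sum_(i <- s) F i theta).
Proof.
move=> hF; elim: s => [|i s IHs].
  under [X in mtrig _ X]funext => theta do rewrite big_nil.
  exact: mtrig_le (mtrig_cst 0).
under [X in mtrig _ X]funext => theta do rewrite big_cons.
exact: (mtrigD (hF i) IHs).
Qed.

Lemma mtrigX (R : realType) (p n k : nat) (F : 'rV[R]_p -> R) :
  mtrig n F -> mtrig (n * k) (fun theta => F theta ^+ k).
Proof.
move=> hF; elim: k => [|k IHk]; first by rewrite muln0; exact: mtrig_cst.
rewrite mulnS; under [X in mtrig _ X]funext => theta do rewrite exprS.
exact: (mtrigM hF IHk).
Qed.

Lemma mtrig_prod (R : realType) (p n : nat) (I : Type) (s : seq I)
    (F : I -> 'rV[R]_p -> R) :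
  (forall i, mtrig n (F i)) ->
  mtrig (n * size s) (fun theta => \prod_(i <- s) F i theta).
Proof.
move=> hF; elim: s => [|i s IHs] /=.
  under [X in mtrig _ X]funext => theta do rewrite big_nil.
  by rewrite muln0; exact: mtrig_cst.
under [X in mtrig _ X]funext => theta do rewrite big_cons.
by rewrite mulnS; exact: (mtrigM (hF i) IHs).
Qed.

Lemma mtrig_shift (R : realType) (p n : nat) (v : 'rV[R]_p) (F : 'rV[R]_p -> R) :
  mtrig n F -> mtrig n (fun theta => F (theta + v)).
Proof.
move=> hF theta l; under [X in trig_deg _ X]funext => t do rewrite addrAC.
exact: hF.
Qed.

(** The coordinates are freed from the grid one by one: by induction on j, [G] vanishes wherever the
    coordinates of index at least j are nodes, because on a line in direction j it is a one-variable
    trigonometric polynomial with enough zeros. *)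
Lemma mtrig_grid (R : realType) (p n : nat) (G : 'rV[R]_p -> R)
    (tau : 'I_(n.*2.+1) -> R) :
  mtrig n G -> injective (circ \o tau) ->
  (forall k : 'I_p -> 'I_(n.*2.+1), G (\row_l tau (k l)) = 0) ->
  forall theta, G theta = 0.
Proof.
move=> hG tau_inj G0 theta.
suff: forall j, (j <= p)%N -> forall theta : 'rV[R]_p,
    (forall l : 'I_p, (j <= l)%N -> exists k, theta 0 l = tau k) -> G theta = 0.
  by apply; first exact: leqnn; move=> l; rewrite leqNgt ltn_ord.
elim=> [_ {}theta grid|j IHj jp {}theta grid].
  pose k l := sval (cid (grid l isT)).
  rewrite -(G0 k); congr G; apply/rowP => l.
  by rewrite mxE /k; case: cid.
pose l0 := Ordinal jp.
(* The line through [theta] reaches the i-th node at t = [tau i - theta 0 l0], and [theta] itself is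
   its point t = 0. *)
have := @trig_deg_eq0 _ _ _ (fun i => tau i - theta 0 l0) (hG theta l0).
move=> /(_ _ _ 0); rewrite scale0r addr0; apply=> [a b /= | k].
  rewrite !circD => /(mulIf (circ_neq0 _)); exact: tau_inj.
apply: IHj => [|l]; first exact: ltnW.
rewrite leq_eqVlt => /orP[/eqP jl|/grid[k' k'E]].
  have -> : l = l0 by exact: val_inj.
  by exists k; rewrite !mxE !eqxx /= mulr1 addrC subrK.
case: (eqVneq l l0) => [->|ll0].
  by exists k; rewrite !mxE !eqxx /= mulr1 addrC subrK.
by exists k'; rewrite !mxE (negPf ll0) mulr0 addr0.
Qed.

(** The doubled angles lie in [0, pi], where the cosine, the real part of [circ], is already
    injective. *)
Lemma circ_grid (R : realType) (n : nat) :
  injective (circ \o (fun i : 'I_n.+1 => pi / 2 * (i%:R / n.+1%:R) : R)).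
Proof.
move=> i j /= [cij _].
have piE (x : R) : 2 * (pi / 2 * x) = pi * x by field.
have itv (k : 'I_n.+1) : pi * (k%:R / n.+1%:R) \in `[0 : R, pi]%R.
  rewrite in_itv /= mulr_ge0 ?pi_ge0 ?divr_ge0 //=.
  rewrite ler_piMr ?pi_ge0 // ler_pdivrMr ?ltr0Sn // mul1r ler_nat.
  exact: ltnW.
move: cij; rewrite !piE => /(cos_inj (itv i) (itv j)).
move=> /(mulfI (lt0r_neq0 (pi_gt0 R))) /(mulIf _) => /(_ _)/eqP.
by rewrite eqr_nat invr_eq0 pnatr_eq0 => /(_ isT)/eqP/val_inj.
Qed.

(** The matrix of values on the grid has more rows than columns, so a nonzero row vector annihilates
    it; the resulting relation holds on the grid, hence everywhere by [mtrig_grid]. *)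
Lemma mtrig_dep (R : realType) (p n : nat) (I : finType) (F : I -> 'rV[R]_p -> R) :
  (forall i, mtrig n (F i)) -> (n.*2.+1 ^ p < #|I|)%N ->
  exists2 c : I -> R, exists i, c i != 0
    & forall theta, \sum_i c i * F i theta = 0.
Proof.
move=> hF ltI; set tau := fun i : 'I_(n.*2).+1 => pi / 2 * (i%:R / (n.*2).+1%:R) : R.
pose A := \matrix_(i < #|I|, k < #|{ffun 'I_p -> 'I_n.*2.+1}|)
  F (enum_val i) (\row_l tau (enum_val k l)).
have : kermx A != 0.
  rewrite kermx_eq0 /row_free; apply: contraTneq ltI => rkA.
  by rewrite -rkA -leqNgt; apply: leq_trans (rank_leq_col _) _; rewrite card_ffun !card_ord.
case/rowV0Pn => v /sub_kermxP vA v0.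
exists (fun i => v 0 (enum_rank i)).
  have /rV0Pn[i vi] := v0.
  by exists (enum_val i); rewrite enum_valK.
apply: (@mtrig_grid _ _ n _ tau); [|exact: circ_grid|].
  by apply: mtrig_sum => i; exact: mtrigZ.
move=> k; have /rowP/(_ (enum_rank (finfun k))) := vA.
rewrite !mxE => vAk; rewrite -[RHS]vAk (reindex (@enum_val I predT)) /=; last first.
  by apply: onW_bij; exact: enum_val_bij.
apply: eq_bigr => i _; rewrite enum_valK mxE enum_rankK; congr (_ * F _ _).
by apply/rowP => l; rewrite !mxE ffunE.
Qed.

(** * The exponential of an involution: e^{-iaH} = cos a - i sin a H *)

Lemma real_complex_cvg (R : realType) (u : nat -> R) (l : R) :
  u @ \oo --> l -> (fun n => (u n)%:C%C : Cx R) @ \oo --> (l%:C%C : Cx R).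
Proof.
move=> ul; apply/cvgrPdist_lt => -[e e']; rewrite ltcE /= => /andP[/eqP -> e0].
move/cvgrPdist_lt : ul => /(_ _ e0); apply: filterS => n.
by rewrite -rmorphB normc_def /= expr0n addr0 sqrtr_sqr ltcR.
Qed.

(** Even powers of -iaH are scalar matrices and odd ones are multiples of [H]; as [cos_coeff a n]
    vanishes for odd n and [sin_coeff a n] for even n, one formula covers both parities. *)
Lemma exp_term_involution (R : realType) (d : nat) (H : 'M[R[i]]_d) (a : R) n :
  H *m H = 1%:M ->
  (n`!%:R)^-1 *: ((- ('i * a%:C%C)) *: H) ^+ n =
  (cos_coeff a n)%:C%C *: 1%:M - ('i * (sin_coeff a n)%:C%C) *: H.
Proof.
move=> HH; set z := - ('i * a%:C%C).
have zz : z * z = (- a ^+ 2)%:C%C.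
  by rewrite /z mulrNN mulrACA -expr2 sqrCi -rmorphM mulN1r expr2 rmorphN.
have zH2 : (z *: H) * (z *: H) = (z * z) *: 1%:M.
  by rewrite -mulmxE -scalemxAl -scalemxAr HH scalerA.
have powE j : (z *: H) ^+ j.*2 = ((-1) ^+ j * a ^+ j.*2)%:C%C *: 1%:M.
  elim: j => [|j IHj]; first by rewrite !expr0 mulr1 scale1r.
  rewrite doubleS 2!exprS mulrA zH2 IHj -mulmxE -scalemxAl mul1mx scalerA zz.
  by rewrite -rmorphM /=; congr (_%:C%C *: _); rewrite !exprS; ring.
have factE : (n`!%:R : R[i])^-1 = (n`!%:R^-1 : R)%:C%C by rewrite fmorphV rmorph_nat.
rewrite factE /cos_coeff /sin_coeff /=; move: (n`!%:R^-1) => f.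
have -> : (-1 : R) ^ n./2 = (-1) ^+ n./2 by [].
have [[j nE]|[j nE]] : (exists j, n = j.*2) \/ (exists j, n = j.*2.+1).
- by rewrite -(odd_double_half n); case: (odd n); [right|left]; exists n./2.
- rewrite nE powE odd_double doubleK mul0r mul1r mul0r mul0r mulr0 scale0r subr0.
  by rewrite scalerA -rmorphM mulrC.
rewrite nE exprSr powE /= odd_double /= doubleK -mulmxE -scalemxAl mul1mx.
rewrite !mul0r scale0r sub0r mul1r !scalerA -scaleNr; congr (_ *: _).
by rewrite exprS /z !rmorphM /=; move: (_%:C%C) (_%:C%C) (_%:C%C) (_%:C%C) => ? ? ? ?; ring.
Qed.

Lemma expmx_partial_involution (R : realType) (d : nat) (H : 'M[R[i]]_d) (a : R) n :
  H *m H = 1%:M ->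
  expmx_partial ((- ('i * a%:C%C)) *: H) n =
  (series (cos_coeff a) n)%:C%C *: 1%:M - ('i * (series (sin_coeff a) n)%:C%C) *: H.
Proof.
move=> HH; rewrite /expmx_partial.
under eq_bigr => k _ do rewrite exp_term_involution //.
rewrite sumrB -!scaler_suml -mulr_sumr /series /= !big_mkord.
by congr (_ *: _ - (_ * _) *: _); rewrite rmorph_sum.
Qed.

Lemma expmx_involution (R : realType) (d : nat) (H : 'M[R[i]]_d) (a : R) :
  H *m H = 1%:M ->
  expmx ((- ('i * a%:C%C)) *: H) =
  (cos a)%:C%C *: 1%:M - ('i * (sin a)%:C%C) *: H.
Proof.
move=> HH; apply/matrixP => i j; rewrite !mxE.
under [X in limn X]funext => n do rewrite expmx_partial_involution // !mxE.
apply: (@cvg_lim (Cx R)); first exact: norm_hausdorff.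
have cvgc : series (cos_coeff a) @ \oo --> cos a.
  by rewrite cos.unlock; exact: is_cvg_series_cos_coeff.
have cvgs : series (sin_coeff a) @ \oo --> sin a.
  by rewrite sin.unlock; exact: is_cvg_series_sin_coeff.
apply: (@cvgB (Cx R) (Cx R)).
  by apply: (@cvgMl (Cx R)); exact: real_complex_cvg.
apply: (@cvgMl (Cx R)); apply: (@cvgMr (Cx R)); exact: real_complex_cvg.
Qed.

(** * The model output along one coordinate *)

Definition qnn_output {R : realType} {d p : nat} (H : 'I_p -> 'M[R[i]]_d)
    (M rho : 'M[R[i]]_d) (theta : 'rV[R]_p) : R :=
  let U := qnn_unitary H theta in complex.Re (\tr (U *m rho *m dagger U *m M)).

Lemma daggerM (R : rcfType) (m n k : nat) (A : 'M[R[i]]_(m, n)) (B : 'M[R[i]]_(n, k)) :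
  dagger (A *m B) = dagger B *m dagger A.
Proof. by rewrite /dagger map_mxM trmx_mul. Qed.

Lemma daggerB (R : rcfType) (m n : nat) (A B : 'M[R[i]]_(m, n)) :
  dagger (A - B) = dagger A - dagger B.
Proof. by rewrite /dagger map_mxB linearB. Qed.

Lemma daggerZ (R : rcfType) (m n : nat) (a : R[i]) (A : 'M[R[i]]_(m, n)) :
  dagger (a *: A) = conjc a *: dagger A.
Proof. by rewrite /dagger map_mxZ linearZ. Qed.

Lemma dagger1 (R : rcfType) (n : nat) : dagger (1%:M : 'M[R[i]]_n) = 1%:M.
Proof. by rewrite /dagger map_mx1 trmx1. Qed.

(** Cyclicity of the trace moves the outer factors onto the observable, so that [E] and [E'], which
    will carry the varying parameter, surround a fixed matrix. *)
Lemma trace_sandwich (F : comNzRingType) (n : nat) (P E Q rho P' E' Q' M : 'M[F]_n) :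
  \tr (P *m E *m Q *m rho *m (Q' *m (E' *m P')) *m M) =
  \tr (E *m (Q *m rho *m Q') *m E' *m (P' *m M *m P)).
Proof.
have -> : P *m E *m Q *m rho *m (Q' *m (E' *m P')) *m M =
    P *m (E *m (Q *m rho *m Q') *m E' *m (P' *m M)) by rewrite !mulmxA.
by rewrite mxtrace_mulC; congr (\tr _); rewrite !mulmxA.
Qed.

Lemma trace_scalar_pencil (F : comNzRingType) (n : nat) (a b : F) (K X N : 'M[F]_n) :
  \tr ((a *: 1%:M - b *: K) *m X *m (a *: 1%:M + b *: K) *m N) =
  a * a * \tr (X *m N) + a * b * \tr (X *m K *m N)
    - b * a * \tr (K *m X *m N) - b * b * \tr (K *m X *m K *m N).
Proof.
rewrite mulmxBl -!scalemxAl mul1mx.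
rewrite !(mulmxDr, mulmxDl, mulNmx) -!(scalemxAl, scalemxAr) !mulmx1.

rewrite !raddfD /= !raddfN /= !mxtraceZ; ring.
Qed.

(** The index [rev_ord l] occurs exactly once in the ordered product; splitting there leaves a
    prefix and a suffix that do not involve coordinate l. *)
Lemma qnn_unitary_slice (R : realType) (d p : nat) (H : 'I_p -> 'M[R[i]]_d)
    (theta : 'rV[R]_p) (l : 'I_p) :
  exists P Q, forall t, qnn_unitary H (theta + t *: delta_mx 0 l) =
    P *m expmx ((- ('i * (theta 0 l + t)%:C%C)) *: H l) *m Q.
Proof.
pose E th k := expmx ((- ('i * ((th : 'rV[R]_p) 0 (rev_ord k))%:C%C)) *: H (rev_ord k)).
have lin : rev_ord l \in index_enum 'I_p by rewrite mem_index_enum.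
have := index_enum_uniq 'I_p; rewrite /qnn_unitary.
move: (index_enum _) lin => r lr; case/splitPr: lr => s1 s2; rewrite cat_uniq /=.
rewrite negb_or => /and3P[_ /andP[ls1 _] /andP[ls2 _]].
have eqE (s : seq 'I_p) t : rev_ord l \notin s ->
    \prod_(k <- s) E (theta + t *: delta_mx 0 l) k = \prod_(k <- s) E theta k.
  move=> ls; apply: eq_big_seq => k ks; rewrite /E !mxE eqxx /=.
  suff /negPf -> : rev_ord k != l by rewrite mulr0 addr0.
  by apply: contraNneq ls => <-; rewrite rev_ordK.
have El t : E (theta + t *: delta_mx 0 l) (rev_ord l) =
    expmx ((- ('i * (theta 0 l + t)%:C%C)) *: H l).
  by rewrite /E rev_ordK !mxE !eqxx mulr1.
exists (\prod_(k <- s1) E theta k), (\prod_(k <- s2) E theta k) => t.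
rewrite -El; transitivity (\prod_(k <- s1 ++ rev_ord l :: s2)
  E (theta + t *: delta_mx 0 l) k); first by [].
move: E eqE {El} => E eqE.
by rewrite big_cat big_cons !eqE //; exact: mulmxA.
Qed.

(** The left side is the expansion of [trace_scalar_pencil] for a = C and b = iS; the factor i turns
    the real parts of the mixed terms into imaginary parts. *)
Lemma Re_rotation (R : realType) (C S : R) (x y z w : R[i]) :
  complex.Re ((C%:C * C%:C * x + (C%:C * ('i * S%:C)) * y
    - ('i * S%:C * C%:C) * z - ('i * S%:C * ('i * S%:C)) * w)%C) =
  C ^+ 2 * complex.Re x + S ^+ 2 * complex.Re w
    + S * C * (complex.Im z - complex.Im y).
Proof.
by rewrite -complexiE; case: x y z w => [? ?] [? ?] [? ?] [? ?] /=; ring.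
Qed.

Lemma qnn_output_slice (R : realType) (d p : nat) (H : 'I_p -> 'M[R[i]]_d)
    (M rho : 'M[R[i]]_d) (theta : 'rV[R]_p) (l : 'I_p) :
  is_hermitian (H l) -> H l *m H l = 1%:M ->
  exists a b c, forall t, qnn_output H M rho (theta + t *: delta_mx 0 l) =
    a + b * cos (2 * t) + c * sin (2 * t).
Proof.
move=> Hherm HH; have [P [Q UE]] := qnn_unitary_slice H theta l.
pose X := Q *m rho *m dagger Q; pose N := dagger P *m M *m P.
pose K := H l.
pose al := complex.Re (\tr (X *m N)); pose be := complex.Re (\tr (K *m X *m K *m N)).
pose ga := complex.Im (\tr (K *m X *m N)) - complex.Im (\tr (X *m K *m N)).
have EE t : qnn_output H M rho (theta + t *: delta_mx 0 l) =
    cos (theta 0 l + t) ^+ 2 * al + sin (theta 0 l + t) ^+ 2 * be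
    + sin (theta 0 l + t) * cos (theta 0 l + t) * ga.
  rewrite /qnn_output UE expmx_involution // -/K.
  set C := cos _; set S := sin _.
  set E := _ *: _ - _ *: _.
  have dE : dagger E = C%:C%C *: 1%:M + ('i * S%:C%C) *: K.
    rewrite /E daggerB !daggerZ dagger1 (Hherm : dagger K = K) -scaleNr -complexiE.
    congr (_ *: _ + _ *: _); first exact: conjc_real.
    by simpc.
  rewrite !daggerM trace_sandwich -/X -/N dE /E.
  rewrite trace_scalar_pencil -Re_rotation; congr complex.Re.
(* With x = [theta 0 l + t], the double-angle formulas give (al + be)/2 + (al - be)/2 cos 2x + ga/2
   sin 2x; the addition formulas then separate [theta 0 l] from t. *)
exists ((al + be) / 2).
exists ((al - be) / 2 * cos (2 * theta 0 l) + ga / 2 * sin (2 * theta 0 l)).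
exists (ga / 2 * cos (2 * theta 0 l) - (al - be) / 2 * sin (2 * theta 0 l)).
move=> t; rewrite EE !mulr_natl !mulr2n !(cosD, sinD).
have := cos2Dsin2 (theta 0 l); have := cos2Dsin2 t.
set c := cos _; set s := sin _; set c' := cos _; set s' := sin _ => h h'.
have e : s ^+ 2 = 1 - c ^+ 2 by rewrite -h; ring.
have e' : s' ^+ 2 = 1 - c' ^+ 2 by rewrite -h'; ring.
by field: e e'.
Qed.

(** * Continuity of the circuit and of the output *)

(** Stated on real and imaginary parts, so that only the topology of [R] is involved. *)
Definition ccontinuous {R : realType} {T : topologicalType} (f : T -> R[i]) : Prop :=
  continuous (fun x => complex.Re (f x)) /\ continuous (fun x => complex.Im (f x)).

Lemma ccontinuous_cst (R : realType) (T : topologicalType) (c : R[i]) :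
  ccontinuous (fun _ : T => c).
Proof. by split=> x; exact: cvg_cst. Qed.

Lemma ccontinuousD (R : realType) (T : topologicalType) (f g : T -> R[i]) :
  ccontinuous f -> ccontinuous g -> ccontinuous (fun x => f x + g x).
Proof.
move=> [fr fi] [gr gi]; split; under eq_fun => y do rewrite raddfD /=.
  by move=> x; exact: cvgD (fr x) (gr x).
by move=> x; exact: cvgD (fi x) (gi x).
Qed.

Lemma ReM (R : rcfType) (x y : R[i]) :
  complex.Re (x * y) = complex.Re x * complex.Re y - complex.Im x * complex.Im y.
Proof. by case: x y => [? ?] [? ?]. Qed.

Lemma ImM (R : rcfType) (x y : R[i]) :
  complex.Im (x * y) = complex.Re x * complex.Im y + complex.Im x * complex.Re y.
Proof. by case: x y => [? ?] [? ?]. Qed.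

Lemma ccontinuousM (R : realType) (T : topologicalType) (f g : T -> R[i]) :
  ccontinuous f -> ccontinuous g -> ccontinuous (fun x => f x * g x).
Proof.
move=> [fr fi] [gr gi]; split.
  under eq_fun => y do rewrite ReM.
  by move=> x; exact: cvgB (cvgM (fr x) (gr x)) (cvgM (fi x) (gi x)).
under eq_fun => y do rewrite ImM.
by move=> x; exact: cvgD (cvgM (fr x) (gi x)) (cvgM (fi x) (gr x)).
Qed.

Lemma ccontinuous_sum (R : realType) (T : topologicalType) (I : Type) (s : seq I)
    (f : I -> T -> R[i]) :
  (forall i, ccontinuous (f i)) -> ccontinuous (fun x => \sum_(i <- s) f i x).
Proof.
move=> fc; elim: s => [|i s IHs].
  under [X in ccontinuous X]funext => y do rewrite big_nil.
  exact: ccontinuous_cst.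
under [X in ccontinuous X]funext => y do rewrite big_cons.
exact: (ccontinuousD (fc i) IHs).
Qed.

Lemma ccontinuousJ (R : realType) (T : topologicalType) (f : T -> R[i]) :
  ccontinuous f -> ccontinuous (fun x => conjc (f x)).
Proof.
have ReJ (x : R[i]) : complex.Re (conjc x) = complex.Re x by case: x.
have ImJ (x : R[i]) : complex.Im (conjc x) = - complex.Im x by case: x.
move=> [fr fi]; split; first by under eq_fun => y do rewrite ReJ.
by under eq_fun => y do rewrite ImJ; move=> x; exact: cvgN (fi x).
Qed.

Definition mxcontinuous {R : realType} {T : topologicalType} {m n : nat}
    (F : T -> 'M[R[i]]_(m, n)) : Prop :=
  forall i j, ccontinuous (fun x => F x i j).

Lemma mxcontinuous_cst (R : realType) (T : topologicalType) (m n : nat)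
    (A : 'M[R[i]]_(m, n)) : mxcontinuous (fun _ : T => A).
Proof. by move=> i j; exact: ccontinuous_cst. Qed.

Lemma mxcontinuousM (R : realType) (T : topologicalType) (m n k : nat)
    (F : T -> 'M[R[i]]_(m, n)) (G : T -> 'M[R[i]]_(n, k)) :
  mxcontinuous F -> mxcontinuous G -> mxcontinuous (fun x => F x *m G x).
Proof.
move=> Fc Gc i j; under [X in ccontinuous X]funext => y do rewrite mxE.
by apply: ccontinuous_sum => l; exact: (ccontinuousM (Fc i l) (Gc l j)).
Qed.

Lemma mxcontinuous_prod (R : realType) (T : topologicalType) (n : nat) (I : Type)
    (s : seq I) (F : I -> T -> 'M[R[i]]_n) :
  (forall i, mxcontinuous (F i)) -> mxcontinuous (fun x => \prod_(i <- s) F i x).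
Proof.
move=> Fc; elim: s => [|i s IHs].
  under [X in mxcontinuous X]funext => y do rewrite big_nil.
  exact: mxcontinuous_cst.
under [X in mxcontinuous X]funext => y do rewrite big_cons.
exact: (mxcontinuousM (Fc i) IHs).
Qed.

Lemma mxcontinuous_dagger (R : realType) (T : topologicalType) (m n : nat)
    (F : T -> 'M[R[i]]_(m, n)) :
  mxcontinuous F -> mxcontinuous (fun x => dagger (F x)).
Proof.
move=> Fc i j; under [X in ccontinuous X]funext => y do rewrite !mxE.
exact: (ccontinuousJ (Fc j i)).
Qed.

Lemma qnn_unitary_continuous (R : realType) (d p : nat) (H : 'I_p -> 'M[R[i]]_d) :
  (forall l, H l *m H l = 1%:M) -> mxcontinuous (qnn_unitary H).
Proof.
move=> HH; apply: mxcontinuous_prod => l i j.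
under [X in ccontinuous X]funext => th do
  rewrite expmx_involution // !mxE -mulNr.
have coordc : continuous (fun th : 'rV[R]_p => th 0 (rev_ord l)).
  by move=> th; apply: coord_continuous.
apply: ccontinuousD.
  apply: ccontinuousM; last exact: ccontinuous_cst.
  split; last exact: cst_continuous.
  by move=> x; exact: continuous_comp (coordc x) (@continuous_cos _ _).
apply: ccontinuousM; last exact: ccontinuous_cst.
under [X in ccontinuous X]funext => th do rewrite -mulrN -rmorphN /=.
apply: ccontinuousM; first exact: ccontinuous_cst.
split; last exact: cst_continuous.
have sinc : continuous (fun th : 'rV[R]_p => sin (th 0 (rev_ord l))).
  by move=> x; exact: continuous_comp (coordc x) (@continuous_sin _ _).
by move=> x; exact: cvgN (sinc x).
Qed.

Lemma qnn_output_continuous (R : realType) (d p : nat) (H : 'I_p -> 'M[R[i]]_d)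
    (M rho : 'M[R[i]]_d) :
  (forall l, H l *m H l = 1%:M) -> continuous (qnn_output H M rho).
Proof.
move=> /qnn_unitary_continuous Uc; rewrite /qnn_output.
suff [] : ccontinuous (fun th => \tr (qnn_unitary H th *m rho *m
  dagger (qnn_unitary H th) *m M)) by [].
apply: ccontinuous_sum => i.
apply: mxcontinuousM; last exact: mxcontinuous_cst.
apply: mxcontinuousM; last exact: mxcontinuous_dagger.
by apply: mxcontinuousM; last exact: mxcontinuous_cst.
Qed.

(** * Partial derivatives of the loss *)

Lemma is_derive_line (R : realType) (V : normedModType R) (f : V -> R) (x v : V)
    (t df : R) :
  is_derive t 1 (fun s : R => f (x + s *: v)) df <->
  is_derive (x + t *: v) v f df.
Proof.
have quotE h : h^-1 *: (((fun s : R => f (x + s *: v)) \o shift t) (h *: 1)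
      - f (x + t *: v)) =
    h^-1 *: ((f \o shift (x + t *: v)) (h *: v) - f (x + t *: v)).
  by rewrite /= [h%:A]mulr1 scalerDl addrCA.
have [dE DE] : derivable (fun s : R => f (x + s *: v)) t 1 = derivable f (x + t *: v) v /\
    'D_1 (fun s : R => f (x + s *: v)) t = 'D_v f (x + t *: v).
  by rewrite /derivable /derive; under eq_fun do rewrite quotE.
split=> -[h1 h2]; split; [by rewrite -dE|exact: etrans (esym DE) h2|by rewrite dE|].
exact: etrans DE h2.
Qed.

Lemma is_derive_sumseq (R : realType) (V : normedModType R) (I : Type) (s : seq I)
    (f : I -> V -> R) (df : I -> R) (x v : V) :
  (forall i, is_derive x v (f i) (df i)) ->
  is_derive x v (fun y => \sum_(i <- s) f i y) (\sum_(i <- s) df i).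
Proof.
move=> fd; elim: s => [|i s IHs].
  rewrite big_nil; under eq_fun do rewrite big_nil.
  exact: is_derive_cst.
rewrite big_cons; under eq_fun do rewrite big_cons.
exact: (is_deriveD (fd i) IHs).
Qed.

Lemma is_derive_wave (R : realType) (a b c : R) :
  is_derive (0 : R) 1 (fun t => a + b * cos (2 * t) + c * sin (2 * t)) (2 * c).
Proof.
have d2 : is_derive (0 : R) 1 (fun t : R => 2 * t) 2.
  by apply: is_derive_eq; rewrite [_%:A]mulr1.
have dcos : is_derive (0 : R) 1 (fun t : R => cos (2 * t)) 0.
  have := @is_derive1_comp _ cos (fun t : R => 2 * t) 0 _ _ (is_derive_cos _) d2.
  by rewrite mulr0 sin0 oppr0 mul0r.
have dsin : is_derive (0 : R) 1 (fun t : R => sin (2 * t)) 2.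
  have := @is_derive1_comp _ sin (fun t : R => 2 * t) 0 _ _ (is_derive_sin _) d2.
  by rewrite mulr0 cos0 mul1r.
apply: is_derive_eq.
by rewrite !scaler0 !add0r mulr0 add0r [_ *: _]mulrC.
Qed.

(** The partial derivative written with finite shifts of the output instead of a limit, so that its
    trigonometric degree can be read off; [qnn_loss_derive] identifies it with the derivative. *)
Definition loss_grad {R : realType} {d p : nat} (H : 'I_p -> 'M[R[i]]_d)
    (M : 'M[R[i]]_d) (S : seq ('M[R[i]]_d * R)) (l : 'I_p) (theta : 'rV[R]_p) : R :=
  let e := (pi / 4) *: delta_mx 0 l in
  (size S)%:R^-1 * \sum_(s <- S) 2 * (qnn_output H M s.1 theta - s.2) *
    (qnn_output H M s.1 (theta + e) - qnn_output H M s.1 (theta - e)).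

Lemma qnn_output_mtrig (R : realType) (d p : nat) (H : 'I_p -> 'M[R[i]]_d)
    (M rho : 'M[R[i]]_d) :
  (forall l, is_hermitian (H l)) -> (forall l, H l *m H l = 1%:M) ->
  mtrig 1 (qnn_output H M rho).
Proof.
move=> Hherm HH theta l.
have [a [b [c abc]]] := qnn_output_slice M rho theta (Hherm l) (HH l).
under [X in trig_deg _ X]funext => t do rewrite abc.
exact: trig_deg_wave.
Qed.

(** Each summand is a product of two factors of degree 1, the residual and a difference of shifted
    outputs; shifts preserve the degree. *)
Lemma loss_grad_mtrig (R : realType) (d p : nat) (H : 'I_p -> 'M[R[i]]_d)
    (M : 'M[R[i]]_d) (S : seq ('M[R[i]]_d * R)) (l : 'I_p) :
  (forall l, is_hermitian (H l)) -> (forall l, H l *m H l = 1%:M) ->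
  mtrig 2 (loss_grad H M S l).
Proof.
move=> Hherm HH; apply: mtrigZ; apply: mtrig_sum => s.
have h := qnn_output_mtrig M s.1 Hherm HH.
have hB (F G : 'rV[R]_p -> R) : mtrig 1 F -> mtrig 1 G -> mtrig 1 (fun th => F th - G th).
  move=> hF hG; under [X in mtrig _ X]funext => t do rewrite -mulN1r.
  exact: (mtrigD hF (mtrigZ (-1) hG)).
apply: (@mtrigM _ _ 1 1).
  apply: mtrigZ; apply: hB => //.
  exact: (mtrig_le _ (mtrig_cst s.2)).
by apply: hB; exact: mtrig_shift.
Qed.

Lemma qnn_loss_continuous (R : realType) (d p : nat) (H : 'I_p -> 'M[R[i]]_d)
    (M : 'M[R[i]]_d) (S : seq ('M[R[i]]_d * R)) :
  (forall l, H l *m H l = 1%:M) -> continuous (qnn_loss H M S).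
Proof.
move=> HH; have sumc : continuous (fun th => \sum_(s <- S)
    (qnn_output H M s.1 th - s.2) ^+ 2).
  elim: S => [|s S IHS].
    by under eq_fun do rewrite big_nil; exact: cst_continuous.
  under eq_fun do rewrite big_cons expr2.
  have outc : continuous (fun th => qnn_output H M s.1 th - s.2).
    move=> x; have c1 := @qnn_output_continuous _ _ _ _ M s.1 HH x.
    have c2 := @cst_continuous 'rV[R]_p R s.2 x.
    exact: (cvgB c1 c2).
  by move=> x; exact: cvgD (cvgM (outc x) (outc x)) (IHS x).
by move=> x; exact: (cvgM (@cst_continuous 'rV[R]_p R _ x) (sumc x)).
Qed.

(* Parameter-shift rule: g t = a + b cos 2t + c sin 2t satisfies
   g' t = g (t + pi/4) - g (t - pi/4). *)
Lemma qnn_output_derive (R : realType) (d p : nat) (H : 'I_p -> 'M[R[i]]_d)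
    (M rho : 'M[R[i]]_d) (l : 'I_p) (theta : 'rV[R]_p) :
  is_hermitian (H l) -> H l *m H l = 1%:M ->
  is_derive theta (delta_mx 0 l) (qnn_output H M rho)
    (qnn_output H M rho (theta + (pi / 4) *: delta_mx 0 l) -
     qnn_output H M rho (theta - (pi / 4) *: delta_mx 0 l)).
Proof.
move=> Hherm HH; rewrite -[X in is_derive X](addr0 theta) -(scale0r (delta_mx 0 l)).
apply/is_derive_line; have [a [b [c abc]]] := qnn_output_slice M rho theta Hherm HH.
under eq_fun do rewrite abc.
rewrite -scaleNr !abc.
have -> : 2 * (pi / 4) = pi / 2 :> R by field.
have -> : 2 * - (pi / 4) = - (pi / 2) :> R by field.
rewrite cosN sinN cos_pihalf sin_pihalf.
have -> : a + b * 0 + c * 1 - (a + b * 0 + c * -1) = 2 * c by ring.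
exact: is_derive_wave.
Qed.

Lemma qnn_loss_derive (R : realType) (d p : nat) (H : 'I_p -> 'M[R[i]]_d)
    (M : 'M[R[i]]_d) (S : seq ('M[R[i]]_d * R)) (l : 'I_p) (theta : 'rV[R]_p) :
  is_hermitian (H l) -> H l *m H l = 1%:M ->
  is_derive theta (delta_mx 0 l) (qnn_loss H M S) (loss_grad H M S l theta).
Proof.
move=> Hherm HH; rewrite /loss_grad.
apply: is_deriveZ; apply: is_derive_sumseq => s.
have h := qnn_output_derive M s.1 theta Hherm HH.
have dB := is_deriveB h (is_derive_cst s.2 theta (delta_mx 0 l)).
have := is_deriveM dB dB; set g := _ * _; set dg := _ + _ => dBB.
have -> : (fun th => (qnn_output H M s.1 th - s.2) ^+ 2) = g.
  by apply/funext => th; rewrite expr2.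
have <- : dg = 2 * (qnn_output H M s.1 theta - s.2) *
  (qnn_output H M s.1 (theta + (pi / 4) *: delta_mx 0 l) -
   qnn_output H M s.1 (theta - (pi / 4) *: delta_mx 0 l)).
  by rewrite /dg subr0 -scalerDl -mulr2n -[_ *+ 2]mulr_natl.
by [].
Qed.

(** * Local surjectivity of the gradient at a strict minimum *)

Lemma continuous_dist (R : realType) (V : normedModType R) (a : V) :
  continuous (fun x : V => `|x - a|).
Proof.
by move=> x; apply: cvg_norm; apply: cvgB; [exact: cvg_id | exact: cvg_cst].
Qed.

Lemma rV_entry_le_norm (R : realType) (p : nat) (x : 'rV[R]_p) (l : 'I_p) :
  `|x 0 l| <= `|x|.
Proof.
by rewrite [leRHS]mx_normrE; apply: (le_bigmax _ (fun ij => `|x ij.1 ij.2|) (0, l)).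
Qed.

Lemma norm_delta_rV (R : realType) (p : nat) (l : 'I_p) :
  `|delta_mx 0 l : 'rV[R]_p| <= 1.
Proof.
rewrite [leLHS]mx_normrE; apply: bigmax_le => // -[i j] _ /=.
by rewrite mxE; case: andP; rewrite ?normr1 ?normr0.
Qed.

(** Fermat's rule on each coordinate line for the tilted function f - <y, .>; y = 0 gives the usual
    critical point equations. *)
Lemma local_min_grad0 (R : realType) (p : nat) (f : 'rV[R]_p -> R)
    (F : 'I_p -> 'rV[R]_p -> R) (x : 'rV[R]_p) (y : 'I_p -> R) (r : R) :
  (forall theta l, is_derive theta (delta_mx 0 l) f (F l theta)) -> 0 < r ->
  (forall z, `|z - x| < r ->
    f x <= f z - \sum_l y l * (z 0 l - x 0 l)) ->
  forall l, F l x = y l.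
Proof.
move=> fF r0 xmin l; set e : 'rV[R]_p := delta_mx 0 l.
pose h t := f (x + t *: e) - y l * t.
have hd t : is_derive (t : R) 1 h (F l (x + t *: e) - y l).
  have h1 : is_derive t 1 (fun t => f (x + t *: e)) (F l (x + t *: e)).
    exact/is_derive_line.
  have h2 : is_derive t 1 (fun t : R => y l * t) (y l).
    by apply: is_derive_eq; rewrite [_%:A]mulr1.
  exact: is_deriveB.
have h0 : is_derive (0 : R) 1 h 0.
  apply: (@derive1_at_min _ h (- r) r) => [|t _||t].
  - by rewrite ge0_cp // ltW.
  - exact: ex_derive.
  - by rewrite in_itv /= oppr_lt0 r0.
  rewrite in_itv /= -ltr_norml => tr.
  have := xmin (x + t *: e); rewrite /h scale0r addr0 mulr0 subr0.
  rewrite [x + _]addrC addrK => /(_ _)/le_trans; apply.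
    rewrite normrZ; apply: le_lt_trans tr.
    by rewrite ler_piMr // norm_delta_rV.
  rewrite lerD2l lerN2 (bigD1 l) //= big1 => [|k kl].
    by rewrite !mxE !eqxx mulr1 addrK addr0.
  by rewrite !mxE (negPf kl) mulr0 add0r subrr mulr0.
have := @derive_val _ _ _ _ _ _ _ (hd 0); rewrite (@derive_val _ _ _ _ _ _ _ h0).
by rewrite scale0r addr0 => /esym/eqP; rewrite subr_eq0 => /eqP.
Qed.

(** On a small sphere around [a], [f] exceeds [f a] by a positive gap. For small y the tilted
    function is still larger there than at [a], so its minimum over the closed ball is attained in
    the interior, where the gradient of [f] equals y. *)
Lemma strict_min_grad_surj (R : realType) (p : nat) (f : 'rV[R]_p -> R)
    (F : 'I_p -> 'rV[R]_p -> R) (a : 'rV[R]_p) (W : set 'rV[R]_p) :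
  continuous f ->
  (forall theta l, is_derive theta (delta_mx 0 l) f (F l theta)) ->
  (\forall x \near a, x != a -> f a < f x) -> nbhs a W ->
  exists2 eps : R, 0 < eps & forall y : 'I_p -> R, (forall l, `|y l| <= eps) ->
    exists2 x, W x & forall l, F l x = y l.
Proof.
move=> fc fF amin aW.
have [r /= r0 rP] : exists2 r : R, 0 < r &
    forall x, `|x - a| < r -> W x /\ (x != a -> f a < f x).
  have [r r0 rP] := (nbhs_ballP _ _).1 (filterI aW amin).
  exists r => // x xa; apply: rP; rewrite -ball_normE /= distrC //.
pose rho := r / 2; have rho0 : 0 < rho by rewrite divr_gt0.
have rho_r : rho < r by rewrite /rho; lra.
pose nrm (x : 'rV[R]_p) := `|x - a|.
have nrmc : continuous nrm.
  exact: continuous_dist.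
have bnd (P : set R) : P `<=` [set t | t <= rho] -> bounded_set (nrm @^-1` P).
  move=> Prho; exists (rho + `|a|); split; first exact: num_real.
  move=> M ltM x /Prho /= xrho; apply: ltW; apply: le_lt_trans ltM.
  by rewrite -(subrK a x); apply: le_trans (ler_normD _ _) _; rewrite lerD2r.
have cpt (P : set R) : closed P -> P `<=` [set t | t <= rho] -> compact (nrm @^-1` P).
  move=> Pc Prho; apply: bounded_closed_compact; first exact: bnd.
  by apply: closed_comp => // x _; exact: nrmc.
have [gap gap0 gapP] : exists2 gap, 0 < gap & forall x, `|x - a| = rho -> f a + gap <= f x.
  (* The sphere may be empty, as for p = 0; any gap then does. *)
  have [B0|B0] := pselect (nrm @^-1` [set rho] !=set0); last first.
    by exists 1 => // x xrho; case: B0; exists x.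
  have cB : compact (nrm @^-1` [set rho]).
    by apply: cpt; [exact: closed_eq | move=> _ /= ->].
  have [c] := EVT_min_rV B0 cB (continuous_subspaceT fc).
  rewrite inE => cr cmin; exists (f c - f a).
    rewrite subr_gt0; apply: (rP c _).2; first by rewrite [`|_|]cr.
    by apply: contra_eq_neq cr => ->; rewrite /nrm subrr normr0 lt_eqF.
  by move=> x xr; rewrite addrC subrK cmin // inE.
(* In the max norm, |<y, z - a>| is at most p eps rho < gap on the sphere; p + 1 keeps the
   denominator nonzero. *)
pose eps := gap / 2 / (p.+1%:R * rho).
have eps0 : 0 < eps by rewrite !divr_gt0 ?mulr_gt0.
exists eps => // y yeps.
pose lin (z : 'rV[R]_p) := \sum_l y l * (z 0 l - a 0 l).
have linB z : `|z - a| = rho -> lin z < gap.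
  move=> zr; apply: (@le_lt_trans _ _ (\sum_(l < p) eps * rho)).
    apply: ler_sum => l _; apply: le_trans (ler_norm _) _.
    rewrite normrM; apply: ler_pM => //; rewrite -zr.
    by apply: le_trans (rV_entry_le_norm _ l); rewrite !mxE.
  rewrite sumr_const card_ord -mulr_natl.
  apply: (@le_lt_trans _ _ (p.+1%:R * (eps * rho))).
    by rewrite ler_wpM2r ?ler_nat // mulr_ge0 // ltW.
  have -> : p.+1%:R * (eps * rho) = gap / 2.
    have p1 : p.+1%:R != 0 :> R by rewrite pnatr_eq0.
    by rewrite /eps; move: (p.+1%:R) p1 => q q0; field; rewrite q0 (lt0r_neq0 rho0).
  by lra.
pose g z := f z - lin z.
have gc : continuous g.
  have linc : continuous lin.
    rewrite /lin; elim: (index_enum _) => [|l s IHs].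
      by under eq_fun do rewrite big_nil; exact: cst_continuous.
    under eq_fun do rewrite big_cons.
    have c1 : continuous (fun z : 'rV[R]_p => y l * (z 0 l - a 0 l)).
      have c0 : continuous (fun z : 'rV[R]_p => z 0 l - a 0 l).
        have cl : continuous (fun z : 'rV[R]_p => z 0 l) by move=> z; exact: coord_continuous.
        by move=> z; exact: (cvgB (cl z) (@cst_continuous 'rV[R]_p R (a 0 l) z)).
      by move=> z; exact: (cvgM (@cst_continuous 'rV[R]_p R (y l) z) (c0 z)).
    by move=> z; exact: cvgD (c1 z) (IHs z).
  by move=> z; exact: cvgB (fc z) (linc z).
pose K := nrm @^-1` [set t | t <= rho].
have K0 : K !=set0 by exists a; rewrite /K /nrm /= subrr normr0 ltW.
have cK : compact K by apply: cpt => //; exact: closed_le.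
have [x] := EVT_min_rV K0 cK (continuous_subspaceT gc).
rewrite inE => xK xmin.
have gxa : g x <= f a.
  have -> : f a = g a by rewrite /g /lin big1 ?subr0 // => l _; rewrite subrr mulr0.
  by apply: xmin; rewrite inE /K /nrm /= subrr normr0 ltW.
have xrho : `|x - a| < rho.
  rewrite lt_neqAle; apply/andP; split=> //; apply/eqP => xr.
  by have := gapP x xr; have := linB x xr; move: gxa; rewrite /g; lra.
exists x; first by apply: (rP x _).1; exact: lt_trans rho_r.
(* The ball of radius rho - |x - a| around [x] stays inside [K]. *)
apply: (@local_min_grad0 _ _ f F x y (rho - `|x - a|)) => //; first by rewrite subr_gt0.
move=> z zx; have : g x <= g z.
  apply: xmin; rewrite inE /K /nrm /=; apply: ltW.
  have -> : z - a = (z - x) + (x - a) by rewrite addrA subrK.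
  by apply: le_lt_trans (ler_normD _ _) _; rewrite -ltrBrDr.
have -> : \sum_l y l * (z 0 l - x 0 l) = lin z - lin x.
  by rewrite /lin -sumrB; apply: eq_bigr => l _; ring.
by rewrite /g; lra.
Qed.

(** * Periodicity, and strictness of the local minima *)

Lemma circ_period (R : realType) (m : int) : circ (pi * m%:~R : R) = 1.
Proof.
have circ_nat n : circ (pi * n%:R : R) = 1.
  elim: n => [|n IHn]; first by rewrite mulr0 /circ mulr0 cos0 sin0.
  rewrite -natr1 mulrDr circD IHn mul1r mulr1 /circ mulr_natl.
  by rewrite cos2pi sin2pi.
case: m => n; first exact: circ_nat.
rewrite NegzE mulrNz mulrN; have := circD (pi * n.+1%:R : R) (- (pi * n.+1%:R)).
by rewrite subrr circ_nat mul1r => <-; rewrite /circ mulr0 cos0 sin0.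
Qed.

(** If 0 < b - a < pi, then cos 2(b - a) = 1 would force sin (b - a) = 0, whereas the sine is
    positive on (0, pi). *)
Lemma circ_inj_period (R : realType) (a b : R) :
  `|a - b| < pi -> circ a = circ b -> a = b.
Proof.
wlog ab : a b / a <= b => [hw|].
  have [ab|/ltW ba] := leP a b; first exact: hw.
  by rewrite distrC => h1 h2; apply/esym/hw.
rewrite distrC => ba cab; apply/eqP; rewrite eq_le ab /= leNgt; apply/negP => ab'.
have c1 : circ (b - a) = 1.
  by rewrite circD -cab -circD subrr /circ mulr0 cos0 sin0.
have : 0 < sin (b - a).
  by apply: sin_gt0_pi; rewrite subr_gt0 ab' /=; apply: le_lt_trans ba; exact: ler_norm.
have [c2 _] := c1.
have : sin (b - a) ^+ 2 = 0.
  have := cos2Dsin2 (b - a); have := cosD (b - a) (b - a).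
  by rewrite -mulr2n -mulr_natl c2 !expr2; lra.
by move=> /eqP; rewrite expf_eq0 => /eqP ->; rewrite ltxx.
Qed.

Lemma mtrig_periodic (R : realType) (p n : nat) (G : 'rV[R]_p -> R)
    (m : 'I_p -> int) (theta : 'rV[R]_p) :
  mtrig n G -> G (theta + \row_l (pi * (m l)%:~R)) = G theta.
Proof.
move=> hG; rewrite (row_sum_delta (\row_l _)).
elim: (index_enum _) theta => [|l s IHs] theta; first by rewrite big_nil addr0.
rewrite big_cons addrA IHs mxE; have [q _ qE] := hG theta l.
have := qE 0; have := qE (pi * (m l)%:~R); rewrite circ_period scale0r addr0.
have -> : circ (0 : R) = 1 by rewrite /circ mulr0 cos0 sin0.
by rewrite expr1n !mulr1 => <- [].
Qed.

(** A point near [a] with the same value as [a] is itself a local minimum, hence critical. Reduction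
    modulo pi is injective near [a], so only finitely many such points exist there and a smaller
    neighbourhood avoids all of them except [a]. *)
Lemma finite_critical_strict_min (R : realType) (p n : nat) (f : 'rV[R]_p -> R)
    (F : 'I_p -> 'rV[R]_p -> R) (a : 'rV[R]_p) :
  (forall theta l, is_derive theta (delta_mx 0 l) f (F l theta)) ->
  (forall l, mtrig n (F l)) ->
  finite_set [set theta | in_period theta /\ critical_point f theta] ->
  local_min f a -> \forall x \near a, x != a -> f a < f x.
Proof.
move=> fF Ftrig fin amin.
have crit x : local_min f x -> forall l, F l x = 0.
  move=> /(nbhs_ballP _ _).1[r /= r0 rP]; apply: (@local_min_grad0 _ _ f F x (fun=> 0) r) => // z zx.
  under eq_bigr do rewrite mul0r.
  by rewrite big1 // subr0; apply: rP; rewrite -ball_normE /= distrC.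
(* Translation of every coordinate into [0, pi) by a multiple of pi. *)
pose red (x : 'rV[R]_p) := x + \row_l (pi * (- Num.floor (x 0 l / pi))%:~R).
have red_inj x z : `|x - a| < pi / 2 -> `|z - a| < pi / 2 -> red x = red z -> x = z.
  move=> xa za /rowP rxz; apply/rowP => l; apply: circ_inj_period.
    have := rV_entry_le_norm (x - z) l; rewrite !mxE => /le_lt_trans; apply.
    have -> : x - z = (x - a) - (z - a) by rewrite opprB addrA subrK.
    by apply: le_lt_trans (ler_normB _ _) _; lra.
  have := congr1 circ (rxz l); rewrite !mxE !circD !circ_period !mulr1.
  by [].
have red_crit x : local_min f x -> in_period (red x) /\ critical_point f (red x).
  move=> xmin; split=> l.
    rewrite !mxE; have := floor_itv (x 0 l / pi); have := pi_gt0 R => pi0.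
    rewrite ler_pdivlMr // ltr_pdivrMr // rmorphN /= rmorphD /= mulrN => /andP[h1 h2].
    by apply/andP; split; lra.
  have := fF (red x) l; rewrite (mtrig_periodic _ _ (Ftrig l)).
  by rewrite crit.
have [s sE] := (finite_seqP _).1 fin.
have avoid c : \forall x \near a, x != a -> red x != c.
  (* Within distance pi/2 of [a] the value [c] is taken at most once, so at most one point [x0] has
     to be excluded, by the radius |x0 - a|. *)
  have [[x0 [x0a x0a' x0c]]|nx] :=
      pselect (exists x0, [/\ `|x0 - a| < pi / 2, x0 != a & red x0 = c]).
    have x0a_gt0 : 0 < `|x0 - a| by rewrite normr_gt0 subr_eq0.
    apply/nbhs_ballP; exists `|x0 - a| => //= x; rewrite -ball_normE /= distrC => xa _.
    apply/eqP => xc; have x_x0 := red_inj _ _ (lt_trans xa x0a) x0a (etrans xc (esym x0c)).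
    by move: xa; rewrite x_x0 ltxx.
  apply/nbhs_ballP; exists (pi / 2); first by rewrite /= divr_gt0 // pi_gt0.
  move=> x; rewrite -ball_normE /= distrC => xa xna; apply/eqP => xc.
  by apply: nx; exists x.
have avoid_all : \forall x \near a, x != a -> red x \notin s.
  elim: (s) => [|c s' IHs]; first exact: (@filterE _ _ (nbhs_filter a)).
  have := avoid c; apply: filterS2 IHs => x xs xc xa.
  by rewrite inE negb_or xs // xc.
(* For x near [a], the bound [f a <= f z] holds for all z near x too; if f x = f a, this makes x a
   local minimum. *)
have := near_join amin; move: amin avoid_all; apply: filterS3 => x fax xs xmin xa.
rewrite lt_neqAle fax andbT; apply: contra (xs xa) => /eqP fxa.
have : local_min f x by rewrite /local_min -fxa.
move=> /red_crit rx; have : [set` s] (red x) by rewrite -sE.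
by [].
Qed.

(** * Counting monomials against grid points *)

Lemma poly_eq0_inj (R : idomainType) (q : {poly R}) (f : nat -> R) :
  injective f -> (forall k, q.[f k] = 0) -> q = 0.
Proof.
move=> f_inj qf; apply/eqP/negP => /negP q0.
have := @max_poly_roots _ q [seq f k | k <- iota 0 (size q)] q0.
rewrite size_map size_iota ltnn => h; suff : false by []; apply: h.
  by apply/allP => _ /mapP[k _ ->]; rewrite rootE qf.
by rewrite map_inj_uniq ?iota_uniq.
Qed.

(** Serves to encode an exponent vector with entries below [B] as a single integer. *)
Lemma sum_digits (B p n : nat) :
  (\sum_(l < p) (n %/ B ^ l %% B) * B ^ l = n %% B ^ p)%N.
Proof.
elim: p => [|p IHp]; first by rewrite big_ord0 expn0 modn1.
rewrite big_ord_recr /= IHp modn_divl -expnS [RHS](divn_eq _ (B ^ p)) addnC.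
by rewrite modn_dvdm // dvdn_exp2l.
Qed.

(** The mean value bound for the p-th power between m and m + 1. *)
Lemma expn_succ_le (m p : nat) : (m.+1 ^ p <= m ^ p + p * m.+1 ^ p.-1)%N.
Proof.
elim: p => [|p IHp] //=; rewrite !expnS.
case: p IHp => [|p] /= IHp; first by rewrite !expn0; lia.
have le_p : (m ^ p.+1 <= m.+1 ^ p.+1)%N by rewrite leq_exp2r.
have := expnS m.+1 p; nia.
Qed.

(** For large K the left side grows like (4pK)^p = D K^p and the right side like (D + 1) K^p, with D
    = (4p)^p. *)
Lemma grid_lt_monomials (p : nat) : (0 < p)%N ->
  exists K, ((2 * K * p + (4 * p) ^ p).*2.+1 ^ p < ((4 * p) ^ p).+1 * K.+1 ^ p)%N.
Proof.
move=> p0; set D := ((4 * p) ^ p)%N.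
have D0 : (0 < D)%N by rewrite expn_gt0 muln_gt0 p0.
(* Chosen so that 4p(K + 1) = 2Dm while the base on the left is at most 2D(m + 1), for m = 4p(D +
   1). Multiplying by D = (4p)^p and cancelling (2D)^p leaves D (m + 1)^p < (D + 1) m^p. *)
pose K := (2 * D * (D.+1)).-1.
have KE : K.+1 = (2 * D * D.+1)%N by rewrite prednK // !muln_gt0 D0.
exists K; pose m := (4 * p * D.+1)%N.
have base : ((2 * K * p + D).*2.+1 <= 2 * D * m.+1)%N by rewrite /m; nia.
have baseE : (4 * p * K.+1 = 2 * D * m)%N by rewrite /m KE; nia.
have main : (D * m.+1 ^ p < D.+1 * m ^ p)%N.
  have h := expn_succ_le m p.
  have e : (m.+1 ^ p = m.+1 * m.+1 ^ p.-1)%N by rewrite -expnS prednK.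
  have pos : (0 < m.+1 ^ p.-1)%N by rewrite expn_gt0.
  have lt : (D.+1 * p < m.+1)%N by rewrite /m; nia.
  have : (D.+1 * p * m.+1 ^ p.-1 < m.+1 ^ p)%N by rewrite e ltn_pmul2r.
  move: (leq_mul (leqnn D.+1) h); rewrite mulnDr mulnA => h1 h2.
  by rewrite -(ltn_add2r (m.+1 ^ p)) -mulSnr; apply: leq_ltn_trans h1 _; rewrite ltn_add2l.
clearbody m.
rewrite -(ltn_pmul2l D0); apply: (@leq_ltn_trans (D * (2 * D * m.+1) ^ p)).
  by rewrite leq_pmul2l // leq_exp2r.
have -> : (D * (D.+1 * K.+1 ^ p) = D.+1 * (2 * D * m) ^ p)%N.
  by rewrite -baseE expnMn -/D; nia.
have q0 : (0 < (2 * D) ^ p)%N by rewrite expn_gt0 muln_gt0 D0.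
by rewrite 2!(expnMn (2 * D)) mulnCA [ltnRHS]mulnCA ltn_pmul2l.
Qed.

(** * Separation of the minima and the root count *)

(** The numbers cos 2 theta_l and sin 2 theta_l determine a point of the period. Taken as
    coefficients they give distinct polynomials [P (a j)], and some natural number k is not a root
    of the product [Q] of their differences; evaluation at k is the wave. *)
Lemma separating_wave (R : realType) (p N : nat) (a : 'I_N -> 'rV[R]_p) :
  (forall j, in_period (a j)) -> injective a ->
  exists u : 'rV[R]_p -> R, [/\ mtrig 1 u, continuous u & injective (u \o a)].
Proof.
move=> aper ainj.
pose z (i : 'I_p * bool) (th : 'rV[R]_p) :=
  if i.2 then cos (2 * th 0 i.1) else sin (2 * th 0 i.1).
pose P th : {poly R} := \sum_i z i th *: 'X^(enum_rank i).
have PE th i : (P th)`_(enum_rank i) = z i th.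
  rewrite coef_sum (bigD1 i) //= coefZ coefXn eqxx mulr1 big1 ?addr0 // => k ki.
  by rewrite coefZ coefXn (inj_eq val_inj) (inj_eq enum_rank_inj) eq_sym (negPf ki) mulr0.
have Pinj i j : P (a i) = P (a j) -> i = j.
  move=> Pij; apply: ainj; apply/rowP => l; apply: circ_inj_period.
    by have /andP[h1 h2] := aper i l; have /andP[h3 h4] := aper j l;
      rewrite ltr_norml; apply/andP; split; lra.
  have e b : z (l, b) (a i) = z (l, b) (a j) by rewrite -!PE Pij.
  by have := e true; have := e false; rewrite /z /= /circ => -> ->.
pose Q := \prod_(ij : 'I_N * 'I_N | ij.1 != ij.2) (P (a ij.1) - P (a ij.2)).
have Q0 : Q != 0.
  apply/prodf_neq0 => -[i j] /= ij; rewrite subr_eq0.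
  by apply: contraNneq ij => /Pinj ->.
have [k Qk] : exists k : nat, Q.[k%:R] != 0.
  apply: contrapT => nk; move/negP: Q0; apply; apply/eqP.
  apply: (@poly_eq0_inj _ _ (fun k => k%:R)) => [k1 k2 /eqP|k].
    by rewrite eqr_nat => /eqP.
  by apply/eqP/negP => /negP ?; apply: nk; exists k.
exists (fun th => (P th).[k%:R]).
have uE : (fun th => (P th).[k%:R]) = (fun th => \sum_i k%:R ^+ enum_rank i * z i th).
  by apply/funext => th; rewrite horner_sum; apply: eq_bigr => i _;
    rewrite hornerZ hornerXn mulrC.
split.
- rewrite uE; apply: mtrig_sum => -[l b]; apply: mtrigZ => th l'; rewrite /z /=.
  have [->|ll'] := eqVneq l l'.
    have argE t : 2 * (th + t *: delta_mx 0 l') 0 l' = 2 * th 0 l' + 2 * t.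
      by rewrite !mxE !eqxx mulr1 mulrDr.
    case: b => /=.
      under [X in trig_deg _ X]funext => t do rewrite argE cosD.
      have := trig_deg_wave 0 (cos (2 * th 0 l')) (- sin (2 * th 0 l')).
      by under [X in trig_deg _ X]funext => t do rewrite add0r mulNr.
    under [X in trig_deg _ X]funext => t do rewrite argE sinD.
    have := trig_deg_wave 0 (sin (2 * th 0 l')) (cos (2 * th 0 l')).
    by under [X in trig_deg _ X]funext => t do rewrite add0r.
  have argE t : (th + t *: delta_mx 0 l') 0 l = th 0 l.
    by rewrite !mxE (negPf ll') mulr0 addr0.
  under [X in trig_deg _ X]funext => t do rewrite argE.
  exact: trig_deg_le (trig_deg_cst _).
- rewrite uE; elim: (index_enum _) => [|i s IHs].
    by under eq_fun do rewrite big_nil; exact: cst_continuous.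
  under eq_fun do rewrite big_cons.
  have argc : continuous (fun th : 'rV[R]_p => 2 * th 0 i.1).
    have cl : continuous (fun th : 'rV[R]_p => th 0 i.1) by move=> th; exact: coord_continuous.
    by move=> th; exact: (cvgM (@cst_continuous 'rV[R]_p R 2 th) (cl th)).
  have zc : continuous (z i).
    rewrite /z; case: i.2 => th.
      exact: continuous_comp (argc th) (@continuous_cos _ _).
    exact: continuous_comp (argc th) (@continuous_sin _ _).
  by move=> th; exact: cvgD (cvgM (@cst_continuous 'rV[R]_p R _ th) (zc th)) (IHs th).
move=> i j /= uij; apply/eqP/negP => /negP ij; move/negP: Qk; apply.
by rewrite horner_prod (bigD1 (i, j)) //= hornerD hornerN uij subrr mul0r.
Qed.

(** Of the gradient, only its degree and its local surjectivity onto a neighbourhood of 0 enter.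
    Restricting y to a monomial curve in one parameter s replaces polynomials in y by polynomials in
    s. *)
Lemma locally_onto_card (R : realType) (p N : nat) (F : 'I_p -> 'rV[R]_p -> R)
    (u : 'rV[R]_p -> R) (a : 'I_N -> 'rV[R]_p) :
  (0 < p)%N -> (forall l, mtrig 2 (F l)) -> mtrig 1 u -> continuous u ->
  injective (u \o a) ->
  (forall j W, nbhs (a j) W -> exists2 eps : R, 0 < eps &
     forall y : 'I_p -> R, (forall l, `|y l| <= eps) ->
       exists2 x, W x & forall l, F l x = y l) ->
  (N <= (4 * p) ^ p)%N.
Proof.
move=> p0 Ftrig utrig uc uinj onto; rewrite leqNgt; apply/negP => DN.
have [K] := grid_lt_monomials p0; set D := ((4 * p) ^ p)%N in DN * => Klt.
(* The first component is the exponent of [u]; the second holds the exponents of all [F l] as its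
   base-(K+1) digits. *)
pose I : finType := ('I_D.+1 * 'I_(K.+1 ^ p))%type.
pose dig (n l : nat) := (n %/ K.+1 ^ l %% K.+1)%N.
pose mono (i : I) th := (\prod_(l < p) F l th ^+ dig i.2 l) * u th ^+ i.1.
have mono_trig i : mtrig (2 * K * p + D) (mono i).
  apply: mtrigM.
    have := @mtrig_prod R p (2 * K) _ (index_enum 'I_p) (fun l th => F l th ^+ dig i.2 l).
    rewrite [index_enum _]unlock -enumT size_enum_ord; apply=> l.
    apply: mtrig_le (mtrigX _ (Ftrig l)).
    by rewrite leq_mul2l /= -ltnS ltn_mod.
  by apply: mtrig_le (mtrigX _ utrig); rewrite mul1n -ltnS.
have [|c [i0 ci0] crel] := mtrig_dep mono_trig.
  by rewrite card_prod !card_ord.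
(* The intervals of radius [gam] around the values [u (a j)] are disjoint, so points found near
   different minima keep different values of [u]. *)
have [gam gam0 gamP] : exists2 gam : R, 0 < gam &
    forall i j, i != j -> 2 * gam < `|u (a i) - u (a j)|.
  have : \forall g \near (0 : R)^'+, forall ij : 'I_N * 'I_N,
      ij.1 != ij.2 -> 2 * g < `|u (a ij.1) - u (a ij.2)|.
    apply: filter_forall => -[i j] /=.
    have [->|ij] := eqVneq i j; first by near=> g.
    have d0 : 0 < `|u (a i) - u (a j)| / 2.
      rewrite divr_gt0 // normr_gt0 subr_eq0; apply: contra ij => /eqP e.
      by apply/eqP/uinj.
    by have := nbhs_right_lt d0; apply: filterS => g; rewrite ltr_pdivlMr // mulrC.
  move=> h; have := filter_ex (filterI (nbhs_right_gt 0) h).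
  by move=> [g [g0 gP]]; exists g => // i j; exact: (gP (i, j)).
(* One bound for the finitely many j; [del < 1] ensures that the powers of s used below do not
   exceed s. *)
have [del [del0 del1 delP]] : exists del : R, [/\ 0 < del, del < 1 &
    forall j (y : 'I_p -> R), (forall l, `|y l| <= del) ->
      exists2 x, `|u x - u (a j)| < gam & forall l, F l x = y l].
  have : \forall e \near (0 : R)^'+, forall j : 'I_N,
      forall y : 'I_p -> R, (forall l, `|y l| <= e) ->
      exists2 x, `|u x - u (a j)| < gam & forall l, F l x = y l.
    apply: filter_forall => j.
    have [|e e0 eP] := onto j [set x | `|u x - u (a j)| < gam].
      have /cvgrPdist_lt/(_ _ gam0) := uc (a j).
      by apply: filterS => x; rewrite distrC.
    have := nbhs_right_lt e0; apply: filterS => e' e'e y ye'; apply: eP => l.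
    exact: le_trans (ye' l) (ltW e'e).
  move=> h; have := filter_ex (filterI (nbhs_right_gt 0) (filterI (nbhs_right_lt ltr01) h)).
  by move=> [e [e0 [e1 eP]]]; exists e; split.
have coef0_rel s (k : 'I_D.+1) : 0 < s -> s <= del ->
    \sum_(n < K.+1 ^ p) c (k, n) * s ^+ n = 0.
  move=> s0 sdel.
  have s1 : s <= 1 by exact: le_trans sdel (ltW del1).
  (* Along this curve the monomial whose exponents are the base-(K+1) digits of n is s^n. *)
  pose y (l : 'I_p) := s ^+ (K.+1 ^ l).
  have ydel l : `|y l| <= del.
    rewrite /y ger0_norm ?exprn_ge0 // ?(ltW s0) //; apply: le_trans _ sdel.
    by rewrite -[leRHS]expr1 ler_wiXn2l ?expn_gt0 // (ltW s0).
  have /choice[x xP] : forall j, exists x, `|u x - u (a j)| < gam /\ forall l, F l x = y l.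
    by move=> j; have [x] := delP j y ydel; exists x.
  have uxinj : injective (u \o x).
    move=> i j /= uij; apply/eqP/negP => /negP ij.
    have := gamP i j ij; have := (xP i).1; have := (xP j).1; rewrite uij.
    move=> h1 h2; apply/negP; rewrite -leNgt.
    have -> : u (a i) - u (a j) = (u (x j) - u (a j)) - (u (x j) - u (a i)) by ring.
    by apply: le_trans (ler_normB _ _) _; lra.
  (* The relation along the curve as a polynomial in the value of [u]: its degree is at most D, and
     the N > D numbers [u (x j)] are distinct roots. *)
  pose P := \poly_(k < D.+1) (\sum_(n < K.+1 ^ p) c (inord k, n) * s ^+ n).
  have Proot j : P.[u (x j)] = 0.
    rewrite horner_poly -[RHS](crel (x j)).
    under eq_bigr do rewrite mulr_suml.
    rewrite pair_bigA; apply: eq_bigr => -[k' n] _ /=.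
    rewrite inord_val -mulrA /mono /=; congr (_ * (_ * _)).
    under eq_bigr do rewrite (xP j).2 /y -exprM mulnC.
    by rewrite -expr_sum sum_digits modn_small.
  have P0 : P = 0.
    apply: contraTeq DN => P0; rewrite -leqNgt.
    have := @max_poly_roots _ P [seq u (x j) | j : 'I_N] P0.
    rewrite size_map size_enum_ord => /(_ _ _)/(leq_trans _) h.
    have : (N < size P)%N.
      apply: h => //.
        by apply/allP => _ /mapP[j _ ->]; rewrite rootE Proot.
      by rewrite map_inj_uniq ?enum_uniq.
    by move=> /leq_trans/(_ (size_poly _ _)).
  have := congr1 (fun q : {poly R} => q`_k) P0.
  by rewrite coef0 coef_poly ltn_ord inord_val.
case: i0 ci0 => k n /eqP; apply.
(* For fixed k, the coefficient of u^k as a polynomial in s; it vanishes at the infinitely many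
   points del / (m + 1). *)
pose q : {poly R} := \sum_(m < K.+1 ^ p) c (k, m) *: 'X^m.
have qn : q`_n = c (k, n).
  rewrite coef_sum (bigD1 n) //= coefZ coefXn eqxx mulr1 big1 ?addr0 // => m mn.
  by rewrite coefZ coefXn (inj_eq val_inj) eq_sym (negPf mn) mulr0.
rewrite -qn (@poly_eq0_inj _ q (fun m => del / m.+1%:R)) ?coef0 // => [m1 m2|m].
  move=> /(mulfI (lt0r_neq0 del0)) /invr_inj /eqP.
  by rewrite eqr_nat eqSS => /eqP.
rewrite horner_sum -[RHS](coef0_rel (del / m.+1%:R) k) ?divr_gt0 //; last first.
  by rewrite ler_pdivrMr // ler_peMr ?ler1n // ltW.
by apply: eq_bigr => m' _; rewrite hornerZ hornerXn.
Unshelve. all: by end_near.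
Qed.

Unset Implicit Arguments.

Theorem theorem3 (R : realType) (d p : nat) (H : 'I_p -> 'M[R[i]]_d)
  (M : 'M[R[i]]_d) (S : seq ('M[R[i]]_d * R)) :
  (forall l, is_hermitian (H l)) ->
  (forall l, H l *m H l = 1%:M) ->
  is_hermitian M ->
  (forall s, s \in S -> density_matrix s.1) ->
  finite_set [set theta : 'rV[R]_p | in_period theta /\
                 critical_point (qnn_loss H M S) theta] ->
  forall mins : seq 'rV[R]_p, uniq mins ->
    (forall theta, theta \in mins ->
       in_period theta /\ local_min (qnn_loss H M S) theta) ->
    (size mins <= expn (4 * p) p)%N.
Proof.
move=> Hherm HH _ _ fin mins mins_uniq minsP.
(* For p = 0 the bound reads 0^0 = 1, and there is only one parameter vector. *)
have [p0|p0] := posnP p.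
  move: mins mins_uniq {H M S Hherm HH fin minsP}; rewrite {}p0 => mins.
  by case: mins => [|x [|y s]] //=; rewrite (thinmx0 x) (thinmx0 y) inE eqxx.
have gradE theta l := qnn_loss_derive M S theta (Hherm l) (HH l).
have trigE l := loss_grad_mtrig M S l Hherm HH.
have lossc := @qnn_loss_continuous _ _ _ _ M S HH.
pose a (j : 'I_(size mins)) := tnth (in_tuple mins) j.
have aP j : in_period (a j) /\ local_min (qnn_loss H M S) (a j).
  exact/minsP/mem_tnth.
have a_inj : injective a by move=> i j; apply/tuple_uniqP.
have [u [utrig uc uinj]] := separating_wave (fun j => (aP j).1) a_inj.
apply: (locally_onto_card p0 trigE utrig uc uinj) => j W Wa.
apply: (strict_min_grad_surj lossc gradE _ Wa).
exact: finite_critical_strict_min gradE trigE fin (aP j).2.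
Qed.
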